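(* Let $G=(V,E)$ be a graph, $S$ a multiset of vertices of $V$, and $\mathsf{M}=(S,\mathcal{I}_{\mathsf{M}})$ a matroid with rank function $r_{\mathsf{M}}$. On the ground set $E\cup S$ (disjoint union) define, for every $F\subseteq E$ and $T\subseteq S$, $$r'_{KT}(F\cup T)=r_{\mathsf{M}}(S)|V|+\min\Big\{e_F(\mathcal{P})-\sum_{X\in\mathcal{P}}\big(r_{\mathsf{M}}(S)-r_{\mathsf{M}}(T_X)\big):\mathcal{P}\text{ partition of }V\Big\}.$$ (a) $r'_{KT}$ is the rank function of a matroid $\mathsf{M}'_{KT}$ on $E\cup S$. (b) For $F\subseteq E$ and $T\subseteq S$, $F$ is the edge set and $T$ is the root set of an $\mathsf{M}$-based packing of rooted trees in $G$ if and only if $F\cup T$ is independent in $\mathsf{M}'_{KT}$ and $|F\cup T|=r_{\mathsf{M}}(S)|V|$.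
   Context: A multiset $S$ of vertices is a finite collection of vertices with multiplicities; each element of $S$ is located at a vertex, and for $T\subseteq S$ and $X\subseteq V$, $T_X$ denotes the elements of $T$ located in $X$ ($T_v=T_{\{v\}}$). For $F\subseteq E$ and a partition $\mathcal{P}$ of $V$, $e_F(\mathcal{P})$ is the number of edges of $F$ joining different members of $\mathcal{P}$. A rooted tree in $G$ is a pair consisting of a tree of $G$ (possibly a single vertex with no edges) and a root vertex of that tree. A packing of rooted trees is a collection of pairwise edge-disjoint rooted trees. An $\mathsf{M}$-based packing of rooted trees is a packing in which each tree's root is assigned a distinct element of $S$ located at that root vertex (the multiset $T$ of these elements is the root set, so $T\subseteq S$), and for every vertex $v$ of $G$ the set of root-elements of the trees containing $v$ is a basis of $\mathsf{M}$. Its edge set is the union of the edge sets of its trees. A matroid with rank function $r$ is one whose rank function is non-negative, integer-valued, non-decreasing, subcardinal and submodular; $X$ is independent if $r(X)=|X|$. *)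

(* Defs.v *)
From mathcomp Require Import all_boot all_order all_algebra.

Set Implicit Arguments.
Unset Strict Implicit.
Unset Printing Implicit Defensive.

Import Order.TTheory GRing.Theory Num.Theory.
Local Open Scope ring_scope.

Record matroid (U : finType) := Matroid {
  rank : {set U} -> int;
  rank_ge0 : forall X : {set U}, 0 <= rank X;
  rank_le_card : forall X : {set U}, rank X <= #|X|%:Z;
  rank_mono : forall X Y : {set U}, X \subset Y -> rank X <= rank Y;
  rank_submod : forall X Y : {set U},
    rank (X :&: Y) + rank (X :|: Y) <= rank X + rank Y }.

Definition indep (U : finType) (M : matroid U) (X : {set U}) : bool :=
  rank M X == #|X|%:Z.

Definition is_basis (U : finType) (M : matroid U) (B : {set U}) : bool :=
  maxset (indep M) B.

(* A graph is a finite undirected multigraph (parallel edges and loops are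
   allowed) with vertex type V and edge type E; [ends e] lists the two ends of
   e in an arbitrary order, and every notion below ignores that order. *)
Definition joins (V E : finType) (ends : E -> V * V) (e : E) (x y : V) : bool :=
  (ends e == (x, y)) || (ends e == (y, x)).

Definition adj (V E : finType) (ends : E -> V * V) (B : {set E}) : rel V :=
  fun x y => [exists e in B, joins ends e x y].

(* A cycle v_1 e_1 v_2 e_2 ... v_k e_k v_1 with k >= 1 is encoded by the list
   of the pairs (v_i, e_i).  Loops (k = 1) and pairs of parallel edges (k = 2)
   are cycles. *)
Definition is_cycle (V E : finType) (ends : E -> V * V) (c : seq (V * E)) :
    bool :=
  [&& c != [::], uniq (map fst c), uniq (map snd c) &
      path.cycle (fun p q : V * E => joins ends p.2 p.1 q.1) c].

Definition acyclic (V E : finType) (ends : E -> V * V) (B : {set E}) : Prop :=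
  forall c : seq (V * E), is_cycle ends c -> ~~ all (mem B) (map snd c).

Record rooted_subgraph (V E : finType) := RootedSubgraph {
  tverts : {set V};
  tedges : {set E};
  troot : V }.

Definition is_rooted_tree (V E : finType) (ends : E -> V * V)
    (t : rooted_subgraph V E) : Prop :=
  [/\ forall e, e \in tedges t ->
        (ends e).1 \in tverts t /\ (ends e).2 \in tverts t,
      {in tverts t &, forall x y, connect (adj ends (tedges t)) x y},
      acyclic ends (tedges t)
    & troot t \in tverts t].

(* The multiset S of vertices is a finite type of elements together with the
   map loc sending an element to the vertex where it is located. *)
Definition located_in (V S : finType) (loc : S -> V) (T : {set S})
    (X : {set V}) : {set S} := [set s in T | loc s \in X].

(* A packing is a finite family of rooted trees t_i, not a set: one-vertex
   trees may be repeated. The element of S assigned to the root of t_i is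
   sigma i. *)
Definition matroid_based_packing (V E S : finType) (ends : E -> V * V)
    (loc : S -> V) (M : matroid S) (k : nat)
    (t : 'I_k -> rooted_subgraph V E) (sigma : 'I_k -> S) : Prop :=
  [/\ forall i, is_rooted_tree ends (t i),
      forall i j, i != j -> [disjoint tedges (t i) & tedges (t j)],
      injective sigma,
      forall i, loc (sigma i) = troot (t i)
    & forall v, is_basis M [set sigma i | i : 'I_k & v \in tverts (t i)]].

Definition packing_edges (V E : finType) (k : nat)
    (t : 'I_k -> rooted_subgraph V E) : {set E} := \bigcup_i tedges (t i).

Definition packing_roots (S : finType) (k : nat) (sigma : 'I_k -> S) :
    {set S} := [set sigma i | i : 'I_k].

Definition crossing_edges (V E : finType) (ends : E -> V * V) (F : {set E})
    (P : {set {set V}}) : {set E} :=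
  [set e in F | pblock P (ends e).1 != pblock P (ends e).2].

Definition KT_value (V E S : finType) (ends : E -> V * V) (loc : S -> V)
    (M : matroid S) (F : {set E}) (T : {set S}) (P : {set {set V}}) : int :=
  #|crossing_edges ends F P|%:Z
  - \sum_(X in P) (rank M [set: S] - rank M (located_in loc T X)).

Definition singletons (V : finType) : {set {set V}} := [set [set v] | v : V].

Lemma singletons_partition (V : finType) : partition (singletons V) [set: V].
Proof.
apply/and3P; split.
- apply/eqP/setP=> v; rewrite inE; apply/bigcupP; exists [set v].
    by apply/imsetP; exists v.
  by rewrite inE.
- apply/trivIsetP=> _ _ /imsetP[x _ ->] /imsetP[y _ ->] nxy.
  by rewrite disjoints1 inE; apply: contraNneq nxy => ->.
- by apply/imsetP=> -[v _ /setP/(_ v)]; rewrite !inE eqxx.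
Qed.

(* The value at the partition into singletons is only the default of the
   iterated minimum; KT_min_attained and KT_min_le show that this is the
   minimum over all partitions of V. *)
Definition KT_min (V E S : finType) (ends : E -> V * V) (loc : S -> V)
    (M : matroid S) (F : {set E}) (T : {set S}) : int :=
  \big[Order.min/KT_value ends loc M F T (singletons V)]_
    (P : {set {set V}} | partition P [set: V]) KT_value ends loc M F T P.

Lemma KT_min_le (V E S : finType) (ends : E -> V * V) (loc : S -> V)
    (M : matroid S) (F : {set E}) (T : {set S}) (P : {set {set V}}) :
  partition P [set: V] -> KT_min ends loc M F T <= KT_value ends loc M F T P.
Proof. by move=> partP; apply: bigmin_le_cond. Qed.

Lemma KT_min_attained (V E S : finType) (ends : E -> V * V) (loc : S -> V)
    (M : matroid S) (F : {set E}) (T : {set S}) :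
  exists2 P : {set {set V}}, partition P [set: V]
    & KT_min ends loc M F T = KT_value ends loc M F T P.
Proof.
rewrite /KT_min; elim/big_ind: _ => [|x y [P pP ->] [Q pQ ->]|P pP].
- by exists (singletons V); first exact: singletons_partition.
- by rewrite minElt; case: ifP => _; [exists P | exists Q].
- by exists P.
Qed.

Definition KT_rank (V E S : finType) (ends : E -> V * V) (loc : S -> V)
    (M : matroid S) (F : {set E}) (T : {set S}) : int :=
  rank M [set: S] * #|V|%:Z + KT_min ends loc M F T.

(* F \cup T as a subset of the disjoint union of E and S. *)
Definition disj_union (E S : finType) (F : {set E}) (T : {set S}) :
    {set E + S} := [set inl e | e in F] :|: [set inr s | s in T].

(* Main.v *)
Require Import Defs.
From mathcomp Require Import all_boot all_order all_algebra.
From mathcomp Require Import zify.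

Set Implicit Arguments.
Unset Strict Implicit.
Unset Printing Implicit Defensive.

Import Order.TTheory GRing.Theory Num.Theory.
Local Open Scope ring_scope.

(* Write k for the rank of M.  Submodularity of the rank formula is proved by
   uncrossing partitions P1 and P2: take the common refinement of P1 and P2, and the
   join obtained by merging the blocks of P2 into P1 one at a time; each merging
   costs one application of submodularity of M per block met.

   A packing attains the bound because each tree has one vertex more than edges, and
   at least as many edges across a partition as it meets blocks not containing its
   root; the elements rooting the trees that enter a block X make up for k - r(T_X).

   Conversely, the trees are grown from their roots.  Let B(v) be the set of elements
   whose tree already contains v, and let A be the set of unused edges.  The invariant
   is k - r(B(X)) <= d(X) for all nonempty X, where d(X) is the sum over v in X of
   k - |B(v)| minus the number of edges of A inside X, together with d(V) = 0.  A step
   moves an edge uw from A to the tree of some s in B(u) outside the span of B(w); it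
   fails only if some X with d(X) = k - r(B(X)) contains w, not u, and has s in the
   span of B(X).  Such tight sets are closed under nonempty intersections, and
   if B(v) does not span B(X) for some v in a tight X, then X contains both ends of
   another candidate edge; so a candidate step inside a smallest possible tight set is
   not blocked. *)

(** * Ranks and spans *)

Section MatroidTheory.

Variables (U : finType) (M : matroid U).
Implicit Types (A B C : {set U}) (s : U).

Lemma rankU_le A B : rank M (A :|: B) <= rank M A + #|B|%:Z.
Proof.
have := rank_submod M A B; have := rank_ge0 M (A :&: B).
have := rank_le_card M B; lia.
Qed.

Definition spans B s := rank M (s |: B) == rank M B.

Lemma spansN B s : ~~ spans B s -> rank M B + 1 <= rank M (s |: B).
Proof. by rewrite /spans => ne; have := rank_mono M (subsetUr [set s] B); lia. Qed.

Lemma spansN_notin B s : ~~ spans B s -> s \notin B.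
Proof. by apply: contra => sB; rewrite /spans (setUidPr _) ?sub1set. Qed.

Lemma spans_mem B s : s \in B -> spans B s.
Proof. by move=> sB; apply: contraTT sB; apply: spansN_notin. Qed.

(** The elements of A are added one at a time: [s |: B] and [B :|: [set:: l]] both have the rank of
    B and meet in a superset of B, so submodularity leaves no room for their union to have larger
    rank. *)
Lemma rankU_span B A : {in A, forall s, spans B s} -> rank M (B :|: A) = rank M B.
Proof.
rewrite -(set_enum A) => sp; have {sp} : {in enum A, forall s, spans B s}.
  by move=> s sA; apply: sp; rewrite inE.
elim: (enum A) => [_|s l IH sp]; first by rewrite set_nil setU0.
have {}IH : rank M (B :|: [set:: l]) = rank M B.
  by apply: IH => x xl; apply: sp; rewrite inE xl orbT.
rewrite set_cons setUCA.
have /eqP sps : spans B s by apply: sp; rewrite inE eqxx.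
have := rank_submod M (s |: B) (B :|: [set:: l]).
have := rank_mono M (_ : B \subset (s |: B) :&: (B :|: [set:: l])).
have := rank_mono M (_ : B \subset s |: (B :|: [set:: l])).
have -> : (s |: B) :|: (B :|: [set:: l]) = s |: (B :|: [set:: l]).
  by rewrite setUA -(setUA [set s]) setUid -setUA.
rewrite subsetI subsetUr subsetUl.
rewrite (subset_trans (subsetUl _ _) (subsetUr _ _)) => /(_ isT) + /(_ isT).
lia.
Qed.

Lemma rank_span B A : {in A, forall s, spans B s} -> rank M A <= rank M B.
Proof. by move=> /rankU_span <-; apply/rank_mono/subsetUr. Qed.

Lemma spans_sub A B s : A \subset B -> spans A s -> spans B s.
Proof.
move=> AB /eqP sA; have := rank_submod M (s |: A) B; rewrite /spans.
have := rank_mono M (_ : A \subset (s |: A) :&: B).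
rewrite subsetI AB subsetUr -setUA (setUidPr AB) => /(_ isT).
by have := rank_mono M (subsetUr [set s] B); lia.
Qed.

Lemma spans_trans A B s : {in A, forall x, spans B x} -> spans A s -> spans B s.
Proof.
move=> AB /(spans_sub (subsetUr B A)) /eqP e.
rewrite /spans eq_le (rank_mono _ (subsetUr [set s] B)) andbT -(rankU_span AB) -e.
by apply: rank_mono; rewrite setUS // subsetUl.
Qed.

Lemma exists_not_spanned B :
  rank M B < rank M [set: U] -> exists s, ~~ spans B s.
Proof.
move=> lt; apply/existsP; apply: contraTT lt => /existsPn sp.
by rewrite -leNgt; apply: rank_span => s _; apply/negPn/sp.
Qed.

Lemma indep_basis B : #|B|%:Z = rank M B -> rank M B = rank M [set: U] -> is_basis M B.
Proof.
move=> cB rB; apply/maxsetP; split=> [|C iC BC]; first by rewrite /indep -cB.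
apply/esym/eqP; rewrite eqEcard BC.
by move: iC => /eqP; have := rank_mono M (subsetT C); lia.
Qed.

(** If B had smaller rank than the ground set, an element outside its span would enlarge it to an
    independent set, against maximality. *)
Lemma card_basis B : is_basis M B -> rank M B = rank M [set: U] /\ #|B|%:Z = rank M B.
Proof.
move=> /maxsetP[/eqP iB maxB]; split=> //; apply/eqP; rewrite eq_le (rank_mono _ (subsetT B)) /=.
rewrite leNgt; apply/negP=> /exists_not_spanned[s Ns].
have sB := spansN_notin Ns; have := spansN Ns.
have := rank_le_card M (s |: B); rewrite cardsU1 sB => le1 le2.
have /maxB : indep M (s |: B) by rewrite /indep cardsU1 sB; lia.
move=> /(_ (subsetUr _ _)) eB; by rewrite -eB !inE eqxx in sB.
Qed.

End MatroidTheory.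

(** * Rooted trees *)

Section GrownTrees.

Variables (V E : finType) (ends : E -> V * V).
Implicit Types (W : {set V}) (C : {set E}) (e : E) (r u v x y : V).

Lemma joins_sym e x y : joins ends e x y = joins ends e y x.
Proof. by rewrite /joins orbC. Qed.

Lemma joins_ends e : joins ends e (ends e).1 (ends e).2.
Proof. by rewrite /joins -surjective_pairing eqxx. Qed.

Lemma joins_forall (P : pred V) e x y :
  joins ends e x y -> P (ends e).1 && P (ends e).2 = P x && P y.
Proof. by case/orP=> /eqP -> //=; rewrite andbC. Qed.

Lemma adj_sym C x y : adj ends C x y = adj ends C y x.
Proof. by apply/existsP/existsP=> -[e]; rewrite joins_sym => He; exists e. Qed.

Lemma sub_adj C C' : C \subset C' -> subrel (adj ends C) (adj ends C').
Proof.
by move=> sub x y /existsP[e /andP[eC j]]; apply/existsP; exists e; rewrite (subsetP sub).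
Qed.

(** Rooted trees built from the root by attaching one leaf at a time. This form supports inductions
    on trees and is what the growing process produces; [rooted_tree_grown] identifies it with
    [is_rooted_tree]. *)
Inductive grown r : {set V} -> {set E} -> Prop :=
| grown_root : grown r [set r] set0
| grown_step W C e u v : grown r W C -> joins ends e u v -> u \in W ->
    v \notin W -> grown r (v |: W) (e |: C).

Lemma grown_root_in r W C : grown r W C -> r \in W.
Proof. by elim=> [|W' C' e u v _ rW _ _ _]; rewrite !inE //; apply/orP; right. Qed.

Lemma grown_joins r W C e x y :
  grown r W C -> e \in C -> joins ends e x y -> (x \in W) && (y \in W).
Proof.
move=> g; elim: g e x y => {W C} [|W C e u v _ IH juv uW vW] f x y; first by rewrite in_set0.
rewrite !inE => /orP[/eqP-> | fC] jxy; last first.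
  by have /andP[-> ->] := IH _ _ _ fC jxy; rewrite !orbT.
have := joins_forall (mem (v |: W)) jxy; rewrite !inE => <-.
have := joins_forall (mem (v |: W)) juv; rewrite !inE => ->.
by rewrite uW eqxx orbT.
Qed.

Lemma grown_step_notin r W C e u v :
  grown r W C -> joins ends e u v -> v \notin W -> e \notin C.
Proof. by move=> g juv; apply: contra => /(grown_joins g)/(_ juv)/andP[]. Qed.

Lemma grown_card r W C : grown r W C -> #|W| = #|C|.+1.
Proof.
elim=> {W C} [|W C e u v g IH juv uW vW]; first by rewrite cards1 cards0.
by rewrite !cardsU1 vW (grown_step_notin g juv vW) IH.
Qed.

Lemma connect_adj_sym C : connect_sym (adj ends C).
Proof. by apply: sym_connect_sym; apply: adj_sym. Qed.

Lemma grown_connect r W C x : grown r W C -> x \in W -> connect (adj ends C) r x.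
Proof.
move=> g; elim: g x => {W C} [|W C e u v g IH juv uW vW] x.
  by rewrite inE => /eqP ->; apply: connect0.
have sub := connect_sub (fun a b ab => connect1 (sub_adj (subsetUr [set e] C) ab)).
rewrite !inE => /orP[/eqP-> | /IH/sub //].
apply: connect_trans (sub _ _ (IH _ uW)) (connect1 _).
by apply/existsP; exists e; rewrite !inE eqxx.
Qed.

(* A closing cycle must avoid the last added edge, whose end v lies on no other. *)
Lemma grown_acyclic r W C : grown r W C -> acyclic ends C.
Proof.
elim=> {W C} [|W C e u v g IH juv uW vW] c cyc.
  by case/and4P: cyc; case: c => //= p c; rewrite inE.
apply/negP=> /allP cC; have [] := boolP (e \in map snd c); last first.
  move=> ec; move/(_ _ cyc): IH => /negP; apply; apply/allP=> f fc.
  have /= := cC _ fc; rewrite !inE => /orP[/eqP fe|//].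
  by rewrite -fe fc in ec.
case/mapP=> -[x e'] pc /= ee'; subst e'.
(* The cycle is rotated so that it starts with [e]; its other edges then lie in C. *)
case/rot_to: pc => i c' rc.
have {cyc} : is_cycle ends (rot i c).
  by move: cyc; rewrite /is_cycle !map_rot !rot_uniq rot_cycle -!size_eq0 size_rot.
have {cC} : {subset map snd (rot i c) <= e |: C}.
  by move=> f; rewrite map_rot mem_rot; apply: cC.
rewrite {i c}rc => sC /and4P[_ _ /= /andP[ec' _]].
have {}sC p : p \in c' -> p.2 \in C.
  move=> pc; have : p.2 \in map snd c' by apply: map_f.
  move=> p2; have := sC p.2; rewrite /= !inE p2 orbT => /(_ isT) /orP[/eqP pe|//].
  by rewrite -pe p2 in ec'.
have vNjoin y : ~ (joins ends e x y /\ (x \in W) /\ (y \in W)).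
  case=> jxy [xW yW]; move/negP: vW; apply.
  have := joins_forall (mem W) jxy; rewrite !inE xW yW.
  by rewrite (joins_forall (mem W) juv) => /andP[].
(* If [e] is the whole cycle, it is a loop at u, which is in W. Otherwise the cycle edges before and
   after [e] lie in C and put both ends of [e] in W. *)
case: c' sC {ec'} => [|p s] sC /=.
  rewrite andbT => jxx; case: (vNjoin x); split=> //.
  have := joins_forall (pred1 x) jxx; rewrite (joins_forall _ juv) /= eqxx.
  by case/andP=> /eqP ux _; rewrite -ux uW.
case/andP=> jp; rewrite rcons_path => /andP[pth jl].
apply: (vNjoin _ (conj jp (conj _ _))).
  by have /andP[] := grown_joins g (sC _ (mem_last p s)) jl.
have [y jy] : exists y, joins ends p.2 p.1 y.
  by case: s pth jl {sC} => [_ jl|p' s /andP[jp' _] _]; [exists x | exists p'.1].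
by have /andP[] := grown_joins g (sC p (mem_head _ _)) jy.
Qed.

Let next_to (p q : V * E) := joins ends p.2 p.1 q.1.

(* The next_to clause says that c is a walk from y to x, in the encoding of is_cycle. *)
Lemma grown_path r W C x y : grown r W C -> x \in W -> y \in W ->
  exists c : seq (V * E),
    [/\ uniq (rcons (map fst c) x), uniq (map snd c), {subset map fst c <= W},
        {subset map snd c <= C}
      & forall p e, joins ends p.2 p.1 y -> path next_to p (rcons c (x, e))].
Proof.
move=> g; elim: g x y => {W C} [|W C e u v g IH juv uW vW] x y.
  rewrite !inE => /eqP-> /eqP->; exists [::]; split=> // p e /= j.
  by rewrite andbT.
have eC := grown_step_notin g juv vW.
rewrite !inE; have [-> _|_ /= xW] := eqVneq x v; have [->|_ /= yW] := eqVneq y v.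
- by move=> _; exists [::]; split=> // p f /= j; rewrite andbT.
(* The new vertex v is the final vertex x: the path from y to u is prolonged by [e]. *)
- have [c [u1 u2 cW cC pc]] := IH _ _ uW yW.
  exists (rcons c (u, e)); rewrite !map_rcons /=; split.
  + rewrite rcons_uniq u1 mem_rcons inE negb_or andbT.
    by apply/andP; split; [apply: contraNneq vW => -> | apply: contra vW => /cW].
  + by rewrite rcons_uniq u2 andbT; apply: contra eC => /cC.
  + move=> z; rewrite mem_rcons !inE => /orP[/eqP->|/cW->]; by rewrite ?uW orbT.
  + move=> z; rewrite mem_rcons !inE => /orP[->|/cC->]; by rewrite ?orbT.
  + by move=> p f j; rewrite rcons_path pc //= last_rcons.
- move=> _; have [c [u1 u2 cW cC pc]] := IH _ _ xW uW.
  exists ((v, e) :: c); split=> /=.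
  + rewrite u1 mem_rcons inE negb_or andbT.
    by apply/andP; split; [apply: contraNneq vW => -> | apply: contra vW => /cW].
  + by rewrite u2 andbT; apply: contra eC => /cC.
  + by move=> z; rewrite !inE => /orP[->|/cW->]; rewrite ?orbT.
  + by move=> z; rewrite !inE => /orP[->|/cC->]; rewrite ?orbT.
  + by move=> p f j; rewrite /next_to /= j pc //= joins_sym.
- have [c [u1 u2 cW cC pc]] := IH _ _ xW yW; exists c; split=> //.
  + by move=> z /cW zW; rewrite !inE zW orbT.
  + by move=> z /cC zC; rewrite !inE zC orbT.
Qed.

(** An edge of C outside C' would close a cycle with the path of C' between its ends. *)
Lemma acyclic_grown r W C C' : grown r W C' -> C' \subset C -> acyclic ends C ->
  {in C, forall e, ((ends e).1 \in W) && ((ends e).2 \in W)} -> C' = C.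
Proof.
move=> g sub acy CW; apply/eqP; rewrite eqEsubset sub; apply/subsetP=> e eC.
apply/negPn/negP=> eC'.
have /andP[xW yW] := CW e eC.
have [c [u1 u2 cW cC pc]] := grown_path g xW yW.
have := acy (((ends e).1, e) :: c); rewrite /= eC => /(_ _)/negP; apply; last first.
  by apply/allP=> f /cC /(subsetP sub).
rewrite /is_cycle /= -rcons_uniq u1 u2 andbT (pc (_, e)) ?joins_ends // andbT.
by apply: contra eC' => /cC.
Qed.

(** Induction on the number of vertices of W not yet reached by the growing tree. *)
Lemma connected_grown r W C : r \in W ->
  {in C, forall e, ((ends e).1 \in W) && ((ends e).2 \in W)} ->
  {in W, forall x, connect (adj ends C) r x} ->
  exists2 C' : {set E}, C' \subset C & grown r W C'.
Proof.
move=> rW CW conn.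
suff H n (W' : {set V}) C' : (#|W :\: W'| <= n)%N -> W' \subset W -> C' \subset C ->
    grown r W' C' -> exists2 C' : {set E}, C' \subset C & grown r W C'.
  apply: (H _ [set r] set0 (leqnn _)) (grown_root r); first by rewrite sub1set.
  exact: sub0set.
elim: n W' C' => [|n IH] W' C' card W'W C'C g.
  exists C' => //; suff <- : W' = W by [].
  by apply/eqP; rewrite eqEsubset W'W -setD_eq0 -cards_eq0 -leqn0.
have [/eqP e0|/set0Pn[x]] := eqVneq (W :\: W') set0.
  exists C' => //; suff <- : W' = W by [].
  by apply/eqP; rewrite eqEsubset W'W -setD_eq0.
rewrite inE => /andP[xW' xW].
(* The edge to attach is the first one leaving W' on a path of C from r to the unreached vertex
   x. *)
have [u [v [uW' vW' /existsP[e /andP[eC juv]]]]] :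
    exists u v, [/\ u \in W', v \notin W' & adj ends C u v].
  have /connectP[p] := conn x xW; move: (grown_root_in g) => {g}.
  move: r {rW conn IH} => z; elim: p z => [|y p IHp] z zW' /=.
    by move=> _ xz; rewrite xz zW' in xW'.
  case/andP=> zy pth ex; have [yW'|yW'] := boolP (y \in W'); last by exists z, y.
  exact: IHp yW' pth ex.
have /andP[uW vW] : (u \in W) && (v \in W).
  by rewrite -(joins_forall (mem W) juv); apply: CW.
apply: (IH (v |: W') (e |: C')).
- have -> : W :\: (v |: W') = (W :\: W') :\ v.
    by apply/setP=> z; rewrite !inE negb_or andbA.
  by move: card; rewrite (cardsD1 v (W :\: W')) inE vW' vW.
- by rewrite subUset sub1set vW.
- by rewrite subUset sub1set eC.
- exact: grown_step g juv uW' vW'.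
Qed.

Lemma rooted_tree_grown (t : rooted_subgraph V E) :
  is_rooted_tree ends t <-> grown (troot t) (tverts t) (tedges t).
Proof.
split=> [[edg conn acy rt] | g].
  have CW : {in tedges t, forall e, ((ends e).1 \in tverts t) && ((ends e).2 \in tverts t)}.
    by move=> e /edg[-> ->].
  have [C' sub g] := connected_grown rt CW (fun x xW => conn _ _ rt xW).
  by rewrite -(acyclic_grown g sub acy CW).
split.
- by move=> e /(grown_joins g)/(_ (joins_ends e))/andP.
- move=> x y /(grown_connect g) rx /(grown_connect g).
  by apply: connect_trans; rewrite connect_adj_sym.
- exact: grown_acyclic g.
- exact: grown_root_in g.
Qed.

Lemma crossing_joins (F : {set E}) (P : {set {set V}}) e x y : joins ends e x y ->
  (e \in crossing_edges ends F P) = (e \in F) && (pblock P x != pblock P y).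
Proof. by rewrite inE; case/orP=> /eqP -> //=; rewrite eq_sym. Qed.

(** Attaching v by an edge from u adds at most one block to the count, the block of v. If it does
    add that block, then u lies in another block, since otherwise the block was already met; so the
    new edge crosses P. *)
Lemma grown_crossing r W C (P : {set {set V}}) : grown r W C -> partition P [set: V] ->
  (#|[set X in P | (r \notin X) && (X :&: W != set0)]| <= #|crossing_edges ends C P|)%N.
Proof.
move=> + /and3P[/eqP covP trivP _].
elim=> {W C} [|W C e u v g IH juv uW vW].
  rewrite (_ : finset _ = set0) ?cards0 //; apply/setP=> X; rewrite !inE.
  apply/negP=> /and3P[_ rX /set0Pn[y]]; rewrite !inE => /andP[yX /eqP yr].
  by rewrite -yr yX in rX.
have eC := grown_step_notin g juv vW.
set N := finset _ in IH; set N' := finset _.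
have vP : v \in cover P by rewrite covP inE.
have N'N : N' \subset pblock P v |: N.
  apply/subsetP=> X; rewrite !inE => /and3P[XP rX /set0Pn[y]]; rewrite !inE.
  case/andP=> yX /orP[/eqP yv|yW]; last first.
    by rewrite XP rX /=; apply/orP; right; apply/set0Pn; exists y; rewrite inE yX.
  by rewrite -(def_pblock trivP XP yX) yv eqxx.
have crs : crossing_edges ends C P \subset crossing_edges ends (e |: C) P.
  by apply/subsetP=> f; rewrite !inE => /andP[-> ->]; rewrite orbT.
have [sub|/subsetPn[X XN' XN]] := boolP (N' \subset N).
  exact: leq_trans (subset_leq_card sub) (leq_trans IH (subset_leq_card crs)).
have XE : X = pblock P v.
  by have := subsetP N'N X XN'; rewrite in_setU1 (negPf XN) orbF => /eqP.
have XP : X \in P by move: XN'; rewrite inE => /andP[].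
have ecr : e \in crossing_edges ends (e |: C) P.
  rewrite (crossing_joins _ _ juv) !inE eqxx /= -XE; apply: contraNneq XN => uX.
  have uX' : u \in X by rewrite -uX mem_pblock covP inE.
  move: XN'; rewrite !inE XP => /and3P[_ -> _] /=.
  by apply/set0Pn; exists u; rewrite inE uX'.
apply: leq_trans (subset_leq_card N'N) _.
apply: leq_trans (_ : #|e |: crossing_edges ends C P| <= _)%N; last first.
  by apply: subset_leq_card; rewrite subUset sub1set ecr.
rewrite !cardsU1 leq_add // -XE XN lt0b !inE (negPf eC) //.
Qed.

End GrownTrees.

(** * Growing the trees *)

Section Growth.

Variables (V E S : finType) (ends : E -> V * V) (M : matroid S).
Implicit Types (A : {set E}) (B : V -> {set S}) (X Y : {set V}) (e : E) (u v w : V).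

Let k := rank M [set: S].

Definition inner A X : {set E} := [set e in A | ((ends e).1 \in X) && ((ends e).2 \in X)].

(** The set B(X) of the overview: a plain union, not closed under spanning. *)
Definition span_at B X : {set S} := \bigcup_(v in X) B v.

Definition defect A B X : int := \sum_(v in X) (k - #|B v|%:Z) - #|inner A X|%:Z.

Definition feasible A B :=
  (forall X, X != set0 -> k - rank M (span_at B X) <= defect A B X)
  /\ defect A B [set: V] = 0.

Definition tight A B X := defect A B X == k - rank M (span_at B X).

Lemma rank_le_k (C : {set S}) : rank M C <= k.
Proof. exact/rank_mono/subsetT. Qed.

Lemma inner_joins A X e x y : joins ends e x y ->
  (e \in inner A X) = [&& e \in A, x \in X & y \in X].
Proof. by rewrite inE => /(joins_forall (mem X)) ->. Qed.

Lemma span_atU B X Y : span_at B (X :|: Y) = span_at B X :|: span_at B Y.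
Proof. exact: bigcup_setU. Qed.

Lemma sub_span_at B X v : v \in X -> B v \subset span_at B X.
Proof. exact: bigcup_sup. Qed.

Lemma span_at_mono B X Y : X \subset Y -> span_at B X \subset span_at B Y.
Proof. by move=> /setUidPr <-; rewrite span_atU subsetUl. Qed.

Lemma span_at1 B v : span_at B [set v] = B v.
Proof. exact: big_set1. Qed.

Lemma sum_setUI (f : V -> int) X Y :
  \sum_(v in X :&: Y) f v + \sum_(v in X :|: Y) f v
  = \sum_(v in X) f v + \sum_(v in Y) f v.
Proof.
rewrite (big_setID (A := X :|: Y) X) /= (big_setID (A := Y) X) /= [Y :&: X]setIC.
by rewrite (setIidPr (subsetUl X Y)) setDUl setDv set0U addrCA.
Qed.

(** The vertex sum is modular, and the number of edges inside a set is supermodular. *)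
Lemma defect_submod A B X Y :
  defect A B (X :&: Y) + defect A B (X :|: Y) <= defect A B X + defect A B Y.
Proof.
have := sum_setUI (fun v => k - #|B v|%:Z) X Y; rewrite /defect.
have IE : inner A (X :&: Y) = inner A X :&: inner A Y.
  apply/setP=> e; rewrite !inE; case: (e \in A) => //=.
  by rewrite andbACA.
have UE : inner A X :|: inner A Y \subset inner A (X :|: Y).
  apply/subsetP=> e; rewrite !inE.
  by case: (e \in A) => //= /orP[] /andP[-> ->]; rewrite ?orbT.
have := cardsUI (inner A X) (inner A Y); have := subset_leq_card UE.
by rewrite IE; lia.
Qed.

(** * Tight sets and candidate steps *)

Section Feasible.

Variables (A : {set E}) (B : V -> {set S}).
Hypothesis feas : feasible A B.

Lemma defect_ge X : X != set0 -> k - rank M (span_at B X) <= defect A B X.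
Proof. exact: feas.1. Qed.

Lemma defect_ge0 X : 0 <= defect A B X.
Proof.
have [-> | /defect_ge] := eqVneq X set0; last by have := rank_le_k (span_at B X); lia.
rewrite /defect big_set0 (_ : inner A set0 = set0) ?cards0 //.
by apply/setP=> e; rewrite inE !in_set0; case: (e \in A).
Qed.

(** Feasibility gives k - r(B(V)) <= d(V) = 0, and r(B(V)) <= k. The vertex argument makes V
    nonempty. *)
Lemma tightT : V -> tight A B [set: V].
Proof.
move=> v; have V0 : [set: V] != set0 by apply/set0Pn; exists v; rewrite inE.
have := defect_ge V0; rewrite /tight feas.2.
by have := rank_le_k (span_at B [set: V]); lia.
Qed.

(** Submodularity of d and of the rank, with the lower bounds on d for the intersection and the
    union, forces r(B(X)) + r(B(Y)) to equal the sum of the ranks at the intersection and the union.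
    Adding an s spanned on both sides leaves the first sum unchanged, so by submodularity it cannot
    raise the rank at the intersection. *)
Lemma tightI X Y : tight A B X -> tight A B Y -> X :&: Y != set0 ->
  tight A B (X :&: Y)
  /\ forall s, spans M (span_at B X) s -> spans M (span_at B Y) s ->
       spans M (span_at B (X :&: Y)) s.
Proof.
rewrite /tight => /eqP tX /eqP tY I0.
have U0 : X :|: Y != set0.
  by case/set0Pn: I0 => v; rewrite inE => /andP[vX _]; apply/set0Pn; exists v; rewrite inE vX.
have := defect_ge I0; have := defect_ge U0; have := defect_submod A B X Y.
have := rank_submod M (span_at B X) (span_at B Y); rewrite -span_atU.
have sI : span_at B (X :&: Y) \subset span_at B X :&: span_at B Y.
  by rewrite subsetI !span_at_mono ?subsetIl ?subsetIr.
have := rank_mono M sI => h1 h2 h3 h4 h5; split; first by lia.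
move=> s /eqP sX /eqP sY; rewrite /spans.
have := rank_submod M (s |: span_at B X) (s |: span_at B Y).
have : rank M (s |: span_at B (X :&: Y))
    <= rank M ((s |: span_at B X) :&: (s |: span_at B Y)).
  by rewrite -setUIr; apply/rank_mono/setUS.
have : rank M (span_at B (X :|: Y))
    <= rank M ((s |: span_at B X) :|: (s |: span_at B Y)).
  by apply: rank_mono; rewrite span_atU setUSS ?subsetUr.
have := rank_mono M (subsetUr [set s] (span_at B (X :&: Y))).
lia.
Qed.

(** A candidate step inside X: the tree of s may pass along e from u to w. *)
Definition extendable X e u w s :=
  [/\ e \in A, joins ends e u w, u \in X, w \in X & s \in B u /\ ~~ spans M (B w) s].

(* Otherwise every B y, for y in the component Y of v inside X, lies in the span of
   B v; as no edge leaves Y inside X, the defect of Y is at most that of X, so B Y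
   has at least the rank of B X. *)
Lemma exists_extendable X v s : tight A B X -> v \in X ->
  spans M (span_at B X) s -> ~~ spans M (B v) s ->
  exists e u w t, extendable X e u w t.
Proof.
move=> /eqP tX vX sX sv; pose q x y := [&& x \in X, y \in X & adj ends A x y].
pose unstuck := [exists e in A, [exists u in X, [exists w in X,
  joins ends e u w && [exists t in B u, ~~ spans M (B w) t]]]].
have [|/negP ns] := boolP unstuck.
  case/existsP=> e /andP[eA /existsP[u /andP[uX /existsP[w /and3P[wX j]]]]].
  by case/existsP=> t /andP[tu tw]; exists e, u, w, t.
have {ns} step x y : q x y -> {in B y, forall t, spans M (B x) t}.
  move=> /and3P[xX yX /existsP[e /andP[eA j]]] t ty; apply: contraT => tx; case: ns.
  apply/existsP; exists e; rewrite eA; apply/existsP; exists y; rewrite yX.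
  apply/existsP; exists x; rewrite xX joins_sym j; apply/existsP; exists t.
  by rewrite ty tx.
have q_sym : connect_sym q.
  by apply: sym_connect_sym => x y; rewrite /q adj_sym andbCA.
pose Y := [set y in X | connect q v y].
have YB y : y \in Y -> {in B y, forall t, spans M (B v) t}.
  rewrite inE => /andP[_ /connectP[p]].
  elim/last_ind: p y => [|p z IH] y /=; first by move=> _ -> t; apply: spans_mem.
  rewrite rcons_path last_rcons => /andP[pp qz] -> t tz.
  exact: spans_trans (IH _ pp erefl) (step _ _ qz _ tz).
have Y0 : Y != set0 by apply/set0Pn; exists v; rewrite inE vX connect0.
have YX : Y \subset X by apply/subsetP=> y; rewrite inE => /andP[].
have rY : rank M (span_at B Y) <= rank M (B v).
  by apply: rank_span => t /bigcupP[y /YB]; apply.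
have rv : rank M (B v) <= rank M (span_at B X) by apply/rank_mono/sub_span_at.
have dXY : defect A B Y + defect A B (X :\: Y) <= defect A B X.
  rewrite /defect (big_setID (A := X) Y) /= (setIidPr YX).
  have : inner A X \subset inner A Y :|: inner A (X :\: Y).
    apply/subsetP=> e eX; have := eX.
    rewrite in_setU !(inner_joins _ _ (joins_ends ends e)) => /and3P[eA xX yX].
    have qe : q (ends e).1 (ends e).2.
      by rewrite /q xX yX; apply/existsP; exists e; rewrite eA joins_ends.
    rewrite !inE eA xX yX /= q_sym (q_sym v) (same_connect q_sym (connect1 qe)).
    by case: connect.
  move=> /subset_leq_card /leq_trans/(_ (leq_card_setU _ _)).
  move: (\sum_(v in Y) _) (\sum_(v in X :\: Y) _) => a b; lia.
(* The element s shows r(B(v)) < r(B(X)). But r(B(Y)) <= r(B(v)) and d(Y) <= d(X), so the invariant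
   at Y and tightness of X give the opposite inequality. *)
have := defect_ge Y0; have := defect_ge0 (X :\: Y); have := spansN sv.
have := rank_mono M (setUS [set s] (sub_span_at B vX)).
by move: sX => /eqP ->; lia.
Qed.

(** For such an X the step lowers d(X) by one while r(B(X)) stays the same, which would break the
    invariant. *)
Definition blocked u w s :=
  exists X, [/\ tight A B X, w \in X, u \notin X & spans M (span_at B X) s].

Lemma exists_unblocked : A != set0 ->
  exists e u w s, extendable [set: V] e u w s /\ ~ blocked u w s.
Proof.
move=> A0.
have main n X e u w s : (#|X| <= n)%N -> tight A B X -> extendable X e u w s ->
    exists e u w s, extendable [set: V] e u w s /\ ~ blocked u w s.
  elim: n X e u w s => [|n IH] X e u w s cX tX [eA j uX wX [su sw]].
    by move: cX uX; rewrite leqn0 cards_eq0 => /eqP->; rewrite in_set0.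
  have [[Y /and4P[tY wY uY sY]]|nb] :
      (exists Y, [&& tight A B Y, w \in Y, u \notin Y & spans M (span_at B Y) s])
      \/ ~ blocked u w s.
  - have [/existsP|/existsPn nb] := boolP [exists Y : {set V},
      [&& tight A B Y, w \in Y, u \notin Y & spans M (span_at B Y) s]]; first by left.
    by right=> -[Y [h1 h2 h3 h4]]; have := nb Y; rewrite h1 h2 h3 h4.
  (* A blocking set Y gives the tight set [X :&: Y], smaller than X because u is not in Y. It spans
     s while B(w) does not, so it contains a candidate edge and the descent continues. *)
  - have wXY : w \in X :&: Y by rewrite inE wX.
    have I0 : X :&: Y != set0 by apply/set0Pn; exists w.
    have [tXY sXY] := tightI tX tY I0.
    have sX : spans M (span_at B X) s by apply/spans_mem/(subsetP (sub_span_at B uX)).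
    have [e' [u' [w' [s' ext]]]] := exists_extendable tXY wXY (sXY s sX sY) sw.
    apply: IH ext; last exact: tXY.
    rewrite -ltnS; apply: leq_trans cX; apply: proper_card.
    by rewrite properE subsetIl; apply/subsetPn; exists u; rewrite // inE (negPf uY) andbF.
  - by exists e, u, w, s; split=> //; split; rewrite ?inE.
have [e0 e0A] := set0Pn _ A0; have v0 := (ends e0).1.
have [v lt] : exists v, rank M (B v) < k.
  apply/existsP; apply: contraT => /existsPn ge.
  have := feas.2; rewrite /defect.
  have -> : inner A [set: V] = A by apply/setP=> e; rewrite inE !in_setT; case: (e \in A).
  have : \sum_(v in [set: V]) (k - #|B v|%:Z) <= 0.
    apply: sumr_le0 => v _; have := ge v; have := rank_le_card M (B v); lia.
  by move: A0; rewrite -card_gt0; lia.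
have [s Ns] := exists_not_spanned lt.
have tT := tightT v0.
have sT : spans M (span_at B [set: V]) s.
  move: tT; rewrite /tight feas.2 /spans => /eqP h.
  have := rank_le_k (s |: span_at B [set: V]).
  by have := rank_mono M (subsetUr [set s] (span_at B [set: V])); lia.
have [e [u [w [t ext]]]] := exists_extendable tT (in_setT v) sT Ns.
exact: main (leqnn _) tT ext.
Qed.

Definition extend w s v := if v == w then s |: B v else B v.

Lemma span_at_extend w s X : w \in X -> span_at (extend w s) X = s |: span_at B X.
Proof.
move=> wX; apply/setP=> t; rewrite !inE; apply/bigcupP/orP=> [[v vX]|].
  rewrite /extend; case: eqP => [_|_] tv.
    by move: tv; rewrite !inE => /orP[->|tv]; [left | right; apply/bigcupP; exists v].
  by right; apply/bigcupP; exists v.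
case=> [/eqP ->|/bigcupP[v vX tv]]; first by exists w; rewrite // /extend eqxx !inE eqxx.
by exists v => //; rewrite /extend; case: ifP => // _; rewrite inE tv orbT.
Qed.

Lemma span_at_extendN w s X : w \notin X -> span_at (extend w s) X = span_at B X.
Proof.
move=> wX; apply: eq_bigr => v vX; rewrite /extend ifN //.
by apply: contraNneq wX => <-.
Qed.

(** If w is in X, the vertex sum drops by one because s is new in B(w); if u is in X as well, the
    removal of [e] from the edges inside X compensates. *)
Lemma defect_extend e u w s X : extendable [set: V] e u w s ->
  defect (A :\ e) (extend w s) X = defect A B X - ((w \in X) && (u \notin X))%:Z.
Proof.
case=> eA j _ _ [su /spansN_notin sw]; rewrite /defect.
have -> : inner (A :\ e) X = inner A X :\ e.
  by apply/setP=> f; rewrite !inE -andbA.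
have := cardsD1 e (inner A X); rewrite (inner_joins _ _ j) eA /=.
have [wX|wX] := boolP (w \in X); last first.
  rewrite andbF add0n => <-; rewrite subr0; congr (_ - _).
  by apply: eq_bigr => v vX; rewrite /extend ifN //; apply: contraNneq wX => <-.
rewrite !(big_setD1 w wX) /= {1}/extend eqxx cardsU1 sw andbT.
have -> : \sum_(v in X :\ w) (k - #|extend w s v|%:Z) = \sum_(v in X :\ w) (k - #|B v|%:Z).
  by apply: eq_bigr => v; rewrite !inE /extend => /andP[/negPf->].
move: (\sum_(v in X :\ w) _) => a; case: (u \in X) => /=; lia.
Qed.

(** Only a set containing w but not u loses defect, and it loses one. If it is not tight there is
    slack; if it is tight, s is outside the span of B(X) and the rank rises by one. *)
Lemma feasible_extend e u w s :
  extendable [set: V] e u w s -> ~ blocked u w s -> feasible (A :\ e) (extend w s).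
Proof.
move=> ext nb; split=> [X X0|]; last first.
  by rewrite (defect_extend _ ext) feas.2 !inE.
rewrite (defect_extend _ ext); have := defect_ge X0.
have [wX|wX] := boolP (w \in X); last by rewrite span_at_extendN //=; lia.
rewrite span_at_extend //; have [uX|uX] := boolP (u \in X).
  by have := rank_mono M (subsetUr [set s] (span_at B X)) => /=; lia.
have [tX|tX] := boolP (tight A B X).
  have /spansN : ~~ spans M (span_at B X) s by apply/negP=> sX; case: nb; exists X.
  by move: tX => /eqP /=; lia.
have := rank_mono M (subsetUr [set s] (span_at B X)).
by move: tX; rewrite /tight /=; lia.
Qed.

End Feasible.

(** * The growing process *)

Variables (loc : S -> V) (F : {set E}) (T : {set S}).

(* [C s] is the tree rooted at s, grown so far on the vertices v with [s \in B v];
   [A] is the set of edges still unused. *)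
Definition partial_packing A B (C : S -> {set E}) :=
  [/\ feasible A B,
      forall v, B v \subset T,
      {in T, forall s, grown ends (loc s) [set v | s \in B v] (C s)},
      {in T, forall s, [disjoint C s & A]}
        /\ {in T &, forall s t, s != t -> [disjoint C s & C t]}
    & A :|: \bigcup_(s in T) C s = F].

Lemma complete_packing A B C : partial_packing A B C ->
  exists B' C', partial_packing set0 B' C'.
Proof.
move: {2}#|A| (erefl #|A|) => n; elim: n A B C => [|n IH] A B C cA pp.
  by move/eqP: cA; rewrite cards_eq0 => /eqP A0; exists B, C; rewrite -A0.
have A0 : A != set0 by rewrite -card_gt0 cA.
case: pp => feas BT gr [dA dC] FE.
have [e [u [w [s [ext nb]]]]] := exists_unblocked feas A0.
have [eA j _ _ [su /spansN_notin sw]] := ext.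
have sT : s \in T := subsetP (BT u) s su.
pose C' t := if t == s then e |: C t else C t.
have C'A t : t \in T -> [disjoint C' t & A :\ e].
  move=> tT; rewrite /C' -setI_eq0; apply/eqP/setP=> f; rewrite !inE.
  have := disjointFr (dA _ tT) (x := f).
  by case: ifP => _; rewrite ?inE; case: eqP => //= _; case: (f \in C t) => // ->.
have NeC t : t \in T -> e \notin C t.
  by move=> tT; rewrite (disjointFl (dA _ tT) eA).
apply: (IH (A :\ e) (extend B w s) C'); first by move: cA; rewrite (cardsD1 e) eA => -[].
split.
- exact: feasible_extend ext nb.
- move=> v; rewrite /extend; case: ifP => // _.
  by rewrite subUset sub1set sT BT.
- move=> t tT; rewrite /C'; have [->|ts] := eqVneq t s.
    have -> : [set v | s \in extend B w s v] = w |: [set v | s \in B v].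
      apply/setP=> v; rewrite !inE /extend; case: eqVneq => //= _.
      by rewrite !inE eqxx.
    by apply: grown_step (gr _ sT) j _ _; rewrite inE.
  have -> // : [set v | t \in extend B w s v] = [set v | t \in B v]; last exact: gr.
  apply/setP=> v; rewrite !inE /extend; case: eqP => // _.
  by rewrite !inE (negPf ts).
- split=> // t t' tT t'T tt'; rewrite /C'.
  have := dC _ _ tT t'T tt'; rewrite -!setI_eq0 => /eqP d0; apply/eqP/setP=> f.
  have := NeC _ tT; have := NeC _ t'T; have := f_equal (fun D : {set E} => f \in D) d0.
  rewrite !inE; have [ts|_] := eqVneq t s; have [t's|_] := eqVneq t' s => //.
  + by rewrite ts t's eqxx in tt'.
  + by rewrite !inE; case: eqVneq => //= -> _ /negPf->.
  + by rewrite !inE; case: eqVneq => //= -> _ _ /negPf->.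
- rewrite -FE (bigD1 s sT) [X in _ = _ :|: X](bigD1 s sT) /= /C' eqxx.
  rewrite setUA (setUA A); congr (_ :|: _); last first.
    by apply: eq_bigr => t /andP[_ /negPf->].
  apply/setP=> f; rewrite !inE; case: eqVneq => [->|//]; by rewrite eA.
Qed.

End Growth.

(** * Uncrossing partitions *)

Section Partitions.

Variable V : finType.
Implicit Types (P Q R : {set {set V}}) (X Y Z : {set V}) (x y : V).

Definition coarser R P := forall X, X \in P -> exists2 Z, Z \in R & X \subset Z.

Section Pblock.

Variables (P : {set {set V}}) (partP : partition P [set: V]).

Lemma partition_mem_pblock x : x \in pblock P x.
Proof. by rewrite mem_pblock (cover_partition partP) in_setT. Qed.

Lemma partition_pblock_mem x : pblock P x \in P.
Proof. by rewrite pblock_mem // (cover_partition partP) in_setT. Qed.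

Lemma partition_pblock X x : X \in P -> x \in X -> pblock P x = X.
Proof. by case/and3P: partP => _ tr _; apply: def_pblock. Qed.

Lemma block_inhabited X : X \in P -> exists x, x \in X.
Proof.
case/and3P: partP => _ _ P0 XP; apply/set0Pn.
by apply: contraNneq P0 => <-.
Qed.

Lemma coarser_pblock R x y : partition R [set: V] -> coarser R P ->
  pblock P x = pblock P y -> pblock R x = pblock R y.
Proof.
move=> /and3P[_ trR _] RP e.
have [Z ZR sub] := RP _ (partition_pblock_mem x).
rewrite (def_pblock trR ZR (subsetP sub _ (partition_mem_pblock x))).
by rewrite (def_pblock trR ZR (subsetP sub y _)) // e partition_mem_pblock.
Qed.

End Pblock.

(** One step towards the join of two partitions: R is coarsened just enough for Y to lie in a single
    block. *)
Definition merge_meeting R Y : {set {set V}} :=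
  cover [set Z in R | Z :&: Y != set0] |: [set Z in R | Z :&: Y == set0].

Lemma coverP (D : {set {set V}}) x : reflect (exists2 Z, Z \in D & x \in Z) (x \in cover D).
Proof. exact: bigcupP. Qed.

Section Merge.

Variables (R : {set {set V}}) (Y : {set V}).
Hypotheses (partR : partition R [set: V]) (Y0 : Y != set0).

Let met := [set Z in R | Z :&: Y != set0].

Lemma sub_merged : Y \subset cover met.
Proof.
apply/subsetP=> y yY; apply/coverP; exists (pblock R y); last exact: partition_mem_pblock.
rewrite inE partition_pblock_mem //=; apply/set0Pn; exists y.
by rewrite inE partition_mem_pblock.
Qed.

Lemma merged_notin : cover met \notin [set Z in R | Z :&: Y == set0].
Proof.
rewrite inE negb_and; apply/orP; right.
by rewrite (setIidPr sub_merged).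
Qed.

Lemma merge_coarser : coarser (merge_meeting R Y) R.
Proof.
move=> Z ZR; have [m|m] := boolP (Z \in met).
  by exists (cover met); rewrite ?setU11 //; apply: bigcup_sup.
exists Z => //; rewrite inE; apply/orP; right.
by move: m; rewrite !inE ZR /= negbK.
Qed.

Lemma merge_partition : partition (merge_meeting R Y) [set: V].
Proof.
have [/eqP cov tr R0] := and3P partR; apply/and3P; split.
- apply/eqP/setP=> x; rewrite in_setT; apply/coverP.
  have [Z ZR sub] := merge_coarser (partition_pblock_mem partR x).
  by exists Z => //; apply: (subsetP sub); apply: partition_mem_pblock.
- apply: (fun a b c => (trivIsetU1 a b c).1) => [Z||].
  + rewrite inE => /andP[ZR /eqP ZY]; rewrite -setI_eq0; apply/eqP/setP=> x.
    rewrite inE in_set0; apply/negP=> /andP[/coverP[Z' ]]; rewrite inE => /andP[Z'R Z'Y] xZ' xZ.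
    move: Z'Y; rewrite -(partition_pblock partR Z'R xZ') (partition_pblock partR ZR xZ).
    by rewrite ZY eqxx.
  + by apply: (trivIsetS _ tr); apply/subsetP=> Z; rewrite inE => /andP[].
  + by rewrite inE (negPf R0).
- rewrite !inE negb_or (negPf R0) andbT.
  by apply: contraNneq Y0 => c0; rewrite -subset0 c0 sub_merged.
Qed.

(** Here [g] is the weight before the merging and [f] the weight after it; they have to agree only
    on the untouched blocks. *)
Lemma sum_merge (f g : {set V} -> int) :
  {in R, forall Z, Z :&: Y = set0 -> f Z = g Z} ->
  \sum_(Z in merge_meeting R Y) f Z + \sum_(Z in met) g Z = f (cover met) + \sum_(Z in R) g Z.
Proof.
move=> fg; rewrite big_setU1 ?merged_notin //= -addrA; congr (_ + _); rewrite addrC.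
rewrite (bigID (fun Z => Z :&: Y != set0) (mem R)) /=; congr (_ + _).
  by apply: eq_bigl => Z; rewrite inE.
by apply: eq_big => Z; rewrite inE ?negbK // => /andP[ZR /eqP/(fg _ ZR)].
Qed.

End Merge.

(** For nonempty X, the partition at which the rank formula yields the invariant d(X) >= k -
    r(B(X)). *)
Definition isolate (X : {set V}) : {set {set V}} := X |: [set [set v] | v in ~: X].

Lemma isolate_notin X : X != set0 -> X \notin [set [set v] | v in ~: X].
Proof.
case/set0Pn=> x xX; apply/imsetP=> -[v]; rewrite inE => vX XE.
by rewrite XE inE eqxx in vX.
Qed.

Lemma isolate_partition X : X != set0 -> partition (isolate X) [set: V].
Proof.
move=> X0; apply/and3P; split.
- apply/eqP/setP=> v; rewrite in_setT; apply/coverP; have [vX|vX] := boolP (v \in X).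
    by exists X; rewrite // setU11.
  by exists [set v]; rewrite ?inE ?eqxx // imset_f ?orbT // inE.
- apply: (fun a b c => (trivIsetU1 a b c).1) => [_ /imsetP[v vX ->]||].
  + by rewrite disjoint_sym disjoints1; rewrite inE in vX.
  + apply/trivIsetP=> _ _ /imsetP[x _ ->] /imsetP[y _ ->] nxy.
    by rewrite disjoints1 inE; apply: contraNneq nxy => ->.
  + by apply/imsetP=> -[v _ /setP/(_ v)]; rewrite in_set0 inE eqxx.
- rewrite !inE negb_or eq_sym X0; apply/imsetP=> -[v _ /setP/(_ v)].
  by rewrite in_set0 inE eqxx.
Qed.

End Partitions.

Lemma ler_sum_inj (I J : finType) (f : I -> J) (A : {set I}) (B : {set J})
    (F : I -> int) (G : J -> int) :
  {in A &, injective f} -> {in A, forall i, f i \in B /\ F i <= G (f i)} ->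
  {in B, forall j, 0 <= G j} -> \sum_(i in A) F i <= \sum_(j in B) G j.
Proof.
move=> injf AB G0; apply: le_trans (_ : \sum_(j in f @: A) G j <= _); last first.
  rewrite [leRHS](big_setID (f @: A)) /= (setIidPr _); last first.
    by apply/subsetP=> _ /imsetP[i /AB[iB _] ->].
  by rewrite lerDl sumr_ge0 // => j; rewrite inE => /andP[_ /G0].
by rewrite big_imset //; apply: ler_sum => i /AB[].
Qed.

(** * Coranks and submodularity of the rank formula *)

Section Corank.

Variables (S : finType) (M : matroid S).
Implicit Types A B D : {set S}.

Definition corank A : int := rank M [set: S] - rank M A.

Lemma corank_ge0 A : 0 <= corank A.
Proof. by rewrite subr_ge0 rank_mono ?subsetT. Qed.

Lemma corank_mono A B : A \subset B -> corank B <= corank A.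
Proof. by move=> AB; rewrite lerD2l lerN2 rank_mono. Qed.

(** The sets [W i] are joined to D one at a time; each application of submodularity has an
    intersection containing [W i :&: D]. *)
Lemma corank_bigcup (I : finType) (Z : {set I}) (W : I -> {set S}) D :
  \sum_(i in Z) corank (W i) + corank D
  <= corank (D :|: \bigcup_(i in Z) W i) + \sum_(i in Z) corank (W i :&: D).
Proof.
rewrite -!big_enum /=; elim: (enum Z) => [|i s IH]; first by rewrite !big_nil setU0 addrC.
rewrite !big_cons setUCA; set U := D :|: _ in IH *.
have := corank_mono (setIS (W i) (subsetUl D (\bigcup_(j <- s) W j))).
have := rank_submod M (W i) U; rewrite -/U.
move: IH; rewrite /corank.
move: (\sum_(j <- s) _) (\sum_(j <- s) _) => a b; lia.
Qed.

End Corank.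

Section KT.

Variables (V E S : finType) (ends : E -> V * V) (loc : S -> V) (M : matroid S).
Implicit Types (F : {set E}) (T : {set S}) (P Q R : {set {set V}}) (Y Z : {set V}).

Lemma KT_valueE F T P : KT_value ends loc M F T P =
  #|crossing_edges ends F P|%:Z - \sum_(X in P) corank M (located_in loc T X).
Proof. by []. Qed.

Section Uncross.

Variables (P1 P2 Q : {set {set V}}) (T1 T2 : {set S}).
Hypotheses (part1 : partition P1 [set: V]) (part2 : partition P2 [set: V]).
Hypotheses (partQ : partition Q [set: V]) (Q1 : coarser P1 Q) (Q2 : coarser P2 Q).

Let T12 := T1 :&: T2.

(* The elements located in Z when only the blocks ys of P2 have been merged into P1. *)
Let W (ys : seq {set V}) Z :=
  [set s | (loc s \in Z) && ((s \in T1) || (s \in T2) && has (fun Y => loc s \in Y) ys)].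

(** Joining the blocks that meet Y costs, by [corank_bigcup], one corank for each such block Z.
    These costs are charged to distinct blocks of Q inside Y. *)
Lemma uncross_step R ys Y : partition R [set: V] -> coarser R P1 -> Y \in P2 ->
  \sum_(Z in R) corank M (W ys Z) + corank M (located_in loc T2 Y)
  <= \sum_(Z in merge_meeting R Y) corank M (W (Y :: ys) Z)
     + \sum_(X in Q | X \subset Y) corank M (located_in loc T12 X).
Proof.
move=> partR R1 YP2; have [y yY] := block_inhabited part2 YP2.
have Y0 : Y != set0 by apply/set0Pn; exists y.
pose met := [set Z in R | Z :&: Y != set0]; pose D := located_in loc T2 Y.
have fg : {in R, forall Z, Z :&: Y = set0 -> corank M (W (Y :: ys) Z) = corank M (W ys Z)}.
  move=> Z ZR ZY; congr (corank M _); apply/setP=> s; rewrite !inE /=.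
  case: (boolP (loc s \in Z)) => //= sZ; case: (boolP (loc s \in Y)) => //= sY.
  by have := in_set0 (loc s); rewrite -ZY inE sZ sY.
have := sum_merge partR Y0 fg; rewrite -/met.
have := corank_bigcup M met (W ys) D.
have : corank M (D :|: \bigcup_(Z in met) W ys Z) <= corank M (W (Y :: ys) (cover met)).
  apply: corank_mono; apply/subsetP=> s; rewrite inE /= => /andP[].
  move=> /coverP[Z Zm sZ] sT; rewrite in_setU [s \in D]inE.
  case: (boolP ((s \in T2) && (loc s \in Y))) => //= nD.
  apply/bigcupP; exists Z => //; rewrite inE sZ /=; move: sT nD.
  by case: (s \in T1); case: (s \in T2); case: (loc s \in Y).
have : \sum_(Z in met) corank M (W ys Z :&: D)
    <= \sum_(X in [set X in Q | X \subset Y]) corank M (located_in loc T12 X).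
  pose pt Z := odflt y [pick x in Z :&: Y].
  have ptP Z : Z \in met -> (pt Z \in Z) && (pt Z \in Y).
    rewrite inE => /andP[_ /set0Pn[x xZY]]; rewrite /pt; case: pickP => [z|/(_ x)].
      by rewrite inE.
    by rewrite xZY.
  have ptQ Z : Z \in met -> pblock Q (pt Z) \subset Z :&: Y.
    move=> Zm; have /andP[pZ pY] := ptP _ Zm.
    have ZR : Z \in R by move: Zm; rewrite inE => /andP[].
    rewrite subsetI; apply/andP; split; apply/subsetP=> x xq.
      rewrite -(partition_pblock partR ZR pZ).
      rewrite (coarser_pblock part1 (y := x) partR R1) ?partition_mem_pblock //.
      apply: (coarser_pblock partQ) => //; apply/esym.
      by apply: (partition_pblock partQ) xq; apply: partition_pblock_mem.
    rewrite -(partition_pblock part2 YP2 pY).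
    rewrite (coarser_pblock partQ (y := x) part2 Q2) ?partition_mem_pblock //.
    by apply/esym/(partition_pblock partQ) => //; apply: partition_pblock_mem.
  apply: (ler_sum_inj (f := fun Z => pblock Q (pt Z))).
  - move=> Z Z' Zm Z'm e; have := ptQ _ Z'm; rewrite -e => /subsetP/(_ (pt Z)).
    rewrite partition_mem_pblock // inE => /(_ isT)/andP[pZ' _].
    have /andP[pZ _] := ptP _ Zm; move: Zm Z'm; rewrite !inE => /andP[ZR _] /andP[Z'R _].
    by rewrite -(partition_pblock partR ZR pZ) (partition_pblock partR Z'R pZ').
  - move=> Z Zm; have := ptQ _ Zm; rewrite subsetI => /andP[qZ qY].
    rewrite inE qY partition_pblock_mem //; split=> //; apply: corank_mono.
    apply/subsetP=> s; rewrite !inE => /andP[/andP[s1 s2] sq].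
    by rewrite s1 s2 (subsetP qZ _ sq) (subsetP qY _ sq).
  - by move=> X _; apply: corank_ge0.
have -> : \sum_(X in [set X in Q | X \subset Y]) corank M (located_in loc T12 X)
    = \sum_(X in Q | X \subset Y) corank M (located_in loc T12 X).
  by apply: eq_bigl => X; rewrite inE.
rewrite -/D; lia.
Qed.

(** R arises from P1 by merging in the blocks of P2 one after another, summing [uncross_step]. *)
Lemma uncross_sums : exists R, [/\ partition R [set: V], coarser R P1, coarser R P2
  & \sum_(X in P1) corank M (located_in loc T1 X) + \sum_(Y in P2) corank M (located_in loc T2 Y)
    <= \sum_(Z in R) corank M (located_in loc (T1 :|: T2) Z)
       + \sum_(X in Q) corank M (located_in loc T12 X)].
Proof.
(* As Q refines P2, each block of Q lies in exactly one block of P2, so it is charged for only one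
   Y. *)
have sumQ : \sum_(Y in P2) \sum_(X in Q | X \subset Y) corank M (located_in loc T12 X)
    = \sum_(X in Q) corank M (located_in loc T12 X).
  rewrite (exchange_big_dep (mem Q)) => [|Y X _ /andP[]//].
  apply: eq_bigr => X XQ; have [x xX] := block_inhabited partQ XQ.
  rewrite (big_pred1 (pblock P2 x)) // => Y /=; rewrite (XQ : X \in Q) /=.
  apply/andP/eqP => [[YP2 XY]|->].
    by rewrite (partition_pblock part2 YP2 (subsetP XY _ xX)).
  rewrite partition_pblock_mem //; split=> //; have [Y' Y'P2 XY] := Q2 XQ.
  by rewrite (partition_pblock part2 Y'P2 (subsetP XY _ xX)).
have [ys ysE sumE] : exists2 ys, ys =i P2 & forall f : {set V} -> int,
    \sum_(Y in P2) f Y = \sum_(Y <- ys) f Y.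
  by exists (enum P2) => [Y|f]; [rewrite mem_enum | rewrite big_enum].
have {ysE} : {subset ys <= P2} /\ {subset P2 <= ys} by split=> Y; rewrite ysE.
case=> ysP2 P2ys; rewrite sumE -sumQ sumE {sumE sumQ}.
have [R [partR R1 Rys le]] : exists R, [/\ partition R [set: V], coarser R P1,
    (forall Y, Y \in ys -> exists2 Z, Z \in R & Y \subset Z)
  & \sum_(X in P1) corank M (located_in loc T1 X) + \sum_(Y <- ys) corank M (located_in loc T2 Y)
    <= \sum_(Z in R) corank M (W ys Z)
       + \sum_(Y <- ys) \sum_(X in Q | X \subset Y) corank M (located_in loc T12 X)].
  elim: ys ysP2 {P2ys} => [|Y ys IH] sub.
    exists P1; split=> [//|X XP|//|]; first by exists X.
    rewrite !big_nil !addr0 le_eqVlt; apply/orP; left; apply/eqP/eq_bigr => X _.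
    by congr (corank M _); apply/setP=> s; rewrite !inE andbF orbF andbC.
  have YP2 : Y \in P2 by apply: sub; rewrite mem_head.
  have [|R [partR R1 Rys le]] := IH; first by move=> X Xys; apply: sub; rewrite inE Xys orbT.
  have [y yY] := block_inhabited part2 YP2.
  have Y0 : Y != set0 by apply/set0Pn; exists y.
  have cR : coarser (merge_meeting R Y) R by apply: merge_coarser.
  exists (merge_meeting R Y); split.
  - exact: merge_partition.
  - move=> X XP1; have [Z ZR XZ] := R1 X XP1; have [Z' Z'R ZZ'] := cR Z ZR.
    by exists Z' => //; apply: subset_trans ZZ'.
  - move=> X; rewrite inE => /orP[/eqP->|Xys].
      by exists (cover [set Z in R | Z :&: Y != set0]); [apply: setU11 | apply: sub_merged].
    have [Z ZR XZ] := Rys X Xys; have [Z' Z'R ZZ'] := cR Z ZR.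
    by exists Z' => //; apply: subset_trans ZZ'.
  - have := uncross_step ys partR R1 YP2; rewrite !big_cons; move: le.
    move: (\sum_(X in P1) _) (\sum_(X <- ys) _) (\sum_(X in R) _) (\sum_(X in merge_meeting R Y) _).
    move: (\sum_(X <- ys) _) (\sum_(X in Q | _) _) => a b c d e f; lia.
exists R; split=> // [Y /P2ys/Rys //|].
suff <- : \sum_(Z in R) corank M (W ys Z) =
  \sum_(Z in R) corank M (located_in loc (T1 :|: T2) Z) by [].
apply: eq_bigr => Z _; congr (corank M _); apply/setP=> s; rewrite !inE andbC.
(* Once all blocks of P2 are merged, every element of T2 is counted, since the blocks cover V. *)
suff -> : has (fun Y => loc s \in Y) ys by rewrite andbT.
by apply/hasP; exists (pblock P2 (loc s)); [apply/P2ys/partition_pblock_mem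
  | apply: partition_mem_pblock].
Qed.

End Uncross.

Lemma KT_value_uncross F1 F2 T1 T2 P1 P2 :
  partition P1 [set: V] -> partition P2 [set: V] ->
  exists R Q, [/\ partition R [set: V], partition Q [set: V]
    & KT_value ends loc M (F1 :&: F2) (T1 :&: T2) Q
      + KT_value ends loc M (F1 :|: F2) (T1 :|: T2) R
      <= KT_value ends loc M F1 T1 P1 + KT_value ends loc M F2 T2 P2].
Proof.
move=> part1 part2; pose f v := (pblock P1 v, pblock P2 v).
(* The common refinement of P1 and P2, as the partition into fibres of the pair of block maps. *)
pose Q := preim_partition f [set: V].
have partQ : partition Q [set: V] := preim_partitionP f [set: V].
have Qf x y : (pblock Q x == pblock Q y) = (f x == f y).
  rewrite eq_pblock ?(cover_partition partQ) ?in_setT //; last by case/and3P: partQ.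
  rewrite pblock_equivalence_partition ?in_setT //.
  by move=> ? ? ? _ _ _; split=> // /eqP->.
have Qsub P : partition P [set: V] -> (forall x y, f x = f y -> pblock P x = pblock P y) ->
    coarser P Q.
  move=> partP fP X XQ; have [x xX] := block_inhabited partQ XQ.
  exists (pblock P x); first exact: partition_pblock_mem.
  apply/subsetP=> y yX; rewrite (fP x y) ?partition_mem_pblock //.
  by apply/eqP; rewrite -Qf !(partition_pblock partQ XQ).
have Q1 : coarser P1 Q by apply: Qsub => // x y [].
have Q2 : coarser P2 Q by apply: Qsub => // x y [].
have [R [partR R1 R2 le]] := uncross_sums T1 T2 part1 part2 partQ Q1 Q2.
exists R, Q; split=> //; rewrite !KT_valueE; move: le.
pose cr F P := crossing_edges ends F P.
have crossR P x y : partition P [set: V] -> coarser R P ->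
    (pblock P x == pblock P y) ==> (pblock R x == pblock R y).
  by move=> partP RP; apply/implyP=> /eqP/(coarser_pblock partP partR RP)/eqP.
(* An edge crossing Q crosses P1 or P2, and an edge crossing R crosses both. The two inclusions, for
   unions and for intersections, bound the sum of the edge counts. *)
have subU : cr (F1 :&: F2) Q :|: cr (F1 :|: F2) R \subset cr F1 P1 :|: cr F2 P2.
  apply/subsetP=> e; rewrite !inE Qf xpair_eqE.
  move: (crossR _ (ends e).1 (ends e).2 part1 R1) (crossR _ (ends e).1 (ends e).2 part2 R2).
  by do 3!case: (_ == _); case: (e \in F1); case: (e \in F2).
have subI : cr (F1 :&: F2) Q :&: cr (F1 :|: F2) R \subset cr F1 P1 :&: cr F2 P2.
  apply/subsetP=> e; rewrite !inE.
  move: (crossR _ (ends e).1 (ends e).2 part1 R1) (crossR _ (ends e).1 (ends e).2 part2 R2).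
  by do 4!case: (_ == _); case: (e \in F1); case: (e \in F2).
have := cardsUI (cr (F1 :&: F2) Q) (cr (F1 :|: F2) R).
have := cardsUI (cr F1 P1) (cr F2 P2).
have := subset_leq_card subU; have := subset_leq_card subI; rewrite /cr.
move: (\sum_(X in P1) _) (\sum_(X in P2) _) (\sum_(X in R) _) (\sum_(X in Q) _) => a b c d.
lia.
Qed.

Lemma KT_rank_submod F1 F2 T1 T2 :
  KT_rank ends loc M (F1 :&: F2) (T1 :&: T2) + KT_rank ends loc M (F1 :|: F2) (T1 :|: T2)
  <= KT_rank ends loc M F1 T1 + KT_rank ends loc M F2 T2.
Proof.
have [P1 part1 E1] := KT_min_attained ends loc M F1 T1.
have [P2 part2 E2] := KT_min_attained ends loc M F2 T2.
have [R [Q [partR partQ le]]] := KT_value_uncross F1 F2 T1 T2 part1 part2.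
have := KT_min_le ends loc M (F1 :|: F2) (T1 :|: T2) partR.
have := KT_min_le ends loc M (F1 :&: F2) (T1 :&: T2) partQ.
by rewrite /KT_rank E1 E2; lia.
Qed.

(** * The remaining matroid axioms for the rank formula *)

Lemma located_in_mono T1 T2 Y : T1 \subset T2 -> located_in loc T1 Y \subset located_in loc T2 Y.
Proof. by move=> /subsetP sub; apply/subsetP=> s; rewrite !inE => /andP[/sub-> ->]. Qed.

Lemma KT_rank_mono F1 F2 T1 T2 : F1 \subset F2 -> T1 \subset T2 ->
  KT_rank ends loc M F1 T1 <= KT_rank ends loc M F2 T2.
Proof.
move=> FF TT; rewrite lerD2l; have [P partP ->] := KT_min_attained ends loc M F2 T2.
apply: le_trans (KT_min_le _ _ _ _ _ partP) _; rewrite !KT_valueE; apply: lerB.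
  rewrite lez_nat; apply/subset_leq_card/subsetP=> e.
  by rewrite !inE => /andP[/(subsetP FF)-> ->].
by apply: ler_sum => X _; apply/corank_mono/located_in_mono.
Qed.

Lemma KT_value_singletons F T : KT_value ends loc M F T (singletons V)
  = #|[set e in F | (ends e).1 != (ends e).2]|%:Z
    - \sum_v corank M (located_in loc T [set v]).
Proof.
rewrite KT_valueE; congr (_ - _); last first.
  by rewrite big_imset //= => x y _ _; apply: set1_inj.
congr Posz; apply: eq_card => e; rewrite !inE; congr (_ && ~~ _).
have P1 x : pblock (singletons V) x = [set x].
  apply: (partition_pblock (singletons_partition V)); first by apply/imsetP; exists x.
  by rewrite inE.
by rewrite !P1; apply/eqP/eqP => [/set1_inj|->].
Qed.

Lemma sum_located T : (\sum_v #|located_in loc T [set v]| = #|T|)%N.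
Proof.
rewrite -[RHS]sum1_card (partition_big loc xpredT) //=; apply: eq_bigr => v _.
by rewrite -sum1_card; apply: eq_bigl => s; rewrite !inE.
Qed.

(** At the partition into singletons the terms k cancel against k|V|, leaving the non-loops of F and
    the ranks r(T_v) <= |T_v|. *)
Lemma KT_rank_le_card F T : KT_rank ends loc M F T <= #|F|%:Z + #|T|%:Z.
Proof.
have := KT_min_le ends loc M F T (singletons_partition V); rewrite KT_value_singletons.
have : (#|[set e in F | (ends e).1 != (ends e).2]| <= #|F|)%N.
  by apply/subset_leq_card/subsetP=> e; rewrite inE => /andP[].
have : \sum_v rank M (located_in loc T [set v]) <= #|T|%:Z.
  rewrite -sum_located (big_morph Posz PoszD (erefl 0%:Z)); apply: ler_sum => v _; exact: rank_le_card.
rewrite /KT_rank /corank sumrB sumr_const -mulr_natr natz.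
set a := \sum_i _; set b := rank M _ * _; lia.
Qed.

(** By monotonicity F and T may be taken empty; then a partition has at most |V| blocks, each
    subtracting at most k. *)
Lemma KT_rank_ge0 F T : 0 <= KT_rank ends loc M F T.
Proof.
apply: le_trans (KT_rank_mono (sub0set F) (sub0set T)).
rewrite /KT_rank; have [P partP ->] := KT_min_attained ends loc M set0 set0.
rewrite KT_valueE.
have : \sum_(X in P) corank M (located_in loc set0 X) <= rank M [set: S] * #|V|%:Z.
  apply: le_trans (_ : \sum_(X in P) rank M [set: S] <= _).
    by apply: ler_sum => X _; rewrite lerBlDr lerDl rank_ge0.
  rewrite sumr_const -mulr_natr natz ler_wpM2l ?rank_ge0 // lez_nat -cardsT.
  rewrite (card_partition partP) -sum1_card; apply: leq_sum => X XP.
  by have [x xX] := block_inhabited partP XP; rewrite card_gt0; apply/set0Pn; exists x.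
by lia.
Qed.

Definition edge_part (A : {set (E + S)%type}) : {set E} := [set e | inl e \in A].
Definition elt_part (A : {set (E + S)%type}) : {set S} := [set s | inr s \in A].

Lemma card_disj_union F T : #|disj_union F T| = (#|F| + #|T|)%N.
Proof.
have d : [set (inl e : E + S) | e in F] :&: [set inr s | s in T] = set0.
  by apply/setP=> x; rewrite inE in_set0; apply/negP=> /andP[/imsetP[e _ ->] /imsetP[]].
rewrite /disj_union cardsU d cards0 subn0 !card_imset //; by move=> ? ? [].
Qed.

Lemma edge_part_disj F T : edge_part (disj_union F T) = F.
Proof.
apply/setP=> e; rewrite !inE; apply/orP/idP=> [[/imsetP[f fF [->]]|/imsetP[]]|eF] //.
by left; apply: imset_f.
Qed.

Lemma elt_part_disj F T : elt_part (disj_union F T) = T.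
Proof.
apply/setP=> e; rewrite !inE; apply/orP/idP=> [[/imsetP[]|/imsetP[f fF [->]]]|eF] //.
by right; apply: imset_f.
Qed.

Lemma disj_union_parts A : disj_union (edge_part A) (elt_part A) = A.
Proof.
apply/setP=> -[e|s]; rewrite inE; apply/orP/idP.
- by case=> /imsetP[] // f; rewrite inE => fA [->].
- by move=> eA; left; apply: imset_f; rewrite inE.
- by case=> /imsetP[] // f; rewrite inE => fA [->].
- by move=> eA; right; apply: imset_f; rewrite inE.
Qed.

Lemma KT_matroid : exists M' : matroid (E + S)%type,
  forall F T, rank M' (disj_union F T) = KT_rank ends loc M F T.
Proof.
pose r A := KT_rank ends loc M (edge_part A) (elt_part A).
have r0 A : 0 <= r A by apply: KT_rank_ge0.
have r_card A : r A <= #|A|%:Z.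
  have := KT_rank_le_card (edge_part A) (elt_part A).
  by rewrite -PoszD -card_disj_union disj_union_parts.
have r_mono (A A' : {set (E + S)%type}) : A \subset A' -> r A <= r A'.
  move=> /subsetP sub; apply: KT_rank_mono; apply/subsetP=> x; rewrite !inE; exact: sub.
have r_sub A A' : r (A :&: A') + r (A :|: A') <= r A + r A'.
  have := KT_rank_submod (edge_part A) (edge_part A') (elt_part A) (elt_part A').
  have -> : edge_part A :&: edge_part A' = edge_part (A :&: A') by apply/setP=> x; rewrite !inE.
  have -> : elt_part A :&: elt_part A' = elt_part (A :&: A') by apply/setP=> x; rewrite !inE.
  have -> : edge_part A :|: edge_part A' = edge_part (A :|: A') by apply/setP=> x; rewrite !inE.
  by have -> : elt_part A :|: elt_part A' = elt_part (A :|: A') by apply/setP=> x; rewrite !inE.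
exists (Matroid r0 r_card r_mono r_sub) => F T /=.
by rewrite /r edge_part_disj elt_part_disj.
Qed.

End KT.

(** * Packings *)

Section Packing.

Variables (V E S : finType) (ends : E -> V * V) (loc : S -> V) (M : matroid S).

(** * The rank of a packing *)

Section FromPacking.

Variables (k : nat) (t : 'I_k -> rooted_subgraph V E) (sigma : 'I_k -> S).
Hypothesis pack : matroid_based_packing ends loc M t sigma.

Let F := packing_edges t.
Let T := packing_roots sigma.

Lemma packing_grown i : grown ends (troot (t i)) (tverts (t i)) (tedges (t i)).
Proof. by apply/rooted_tree_grown; case: pack. Qed.

Lemma packing_sigma_inj : injective sigma.
Proof. by case: pack. Qed.

Lemma packing_basis v :
  is_basis M [set sigma i | i : 'I_k & v \in tverts (t i)].
Proof. by case: pack. Qed.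

(** Used with D all edges to count the packing, and with D the edges crossing a partition to bound
    its value. *)
Lemma card_packing_edges (D : {set E}) : (#|F :&: D| = \sum_i #|tedges (t i) :&: D|)%N.
Proof.
have dis : forall i j, i != j -> [disjoint tedges (t i) & tedges (t j)] by case: pack.
rewrite -sum1_card.
transitivity (\sum_i \sum_(e in tedges (t i) :&: D) 1)%N; last first.
  by apply: eq_bigr => i _; rewrite sum1_card.
rewrite (exchange_big_dep (mem (F :&: D))) /=; last first.
  by move=> i e _; rewrite !inE => /andP[ei ->]; rewrite andbT; apply/bigcupP; exists i.
apply: eq_bigr => e; rewrite inE => /andP[/bigcupP[i _ ei] eD].
rewrite (big_pred1 i) // => j; rewrite !inE eD andbT; apply/idP/eqP => [ej|-> //].
by apply: contraTeq ej => /dis/disjointFl->.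
Qed.

(** Double counting of the pairs of a tree and a vertex on it: each tree has as many vertices as its
    edges plus its root, and each vertex lies on as many trees as a basis has elements. *)
Lemma card_packing : #|F|%:Z + #|T|%:Z = rank M [set: S] * #|V|%:Z.
Proof.
have -> : #|T| = k by rewrite card_imset ?card_ord //; apply: packing_sigma_inj.
have FE : (#|F| = \sum_i #|tedges (t i)|)%N.
  rewrite -[F]setIT card_packing_edges; apply: eq_bigr => i _; by rewrite setIT.
have -> : #|F|%:Z + k%:Z = (\sum_i #|tverts (t i)|)%N%:Z.
  have kE : k = (\sum_(i < k) 1)%N by rewrite sum1_card card_ord.
  rewrite FE [X in _ + X%:Z]kE -PoszD -big_split /=; congr Posz.
  by apply: eq_bigr => i _; rewrite (grown_card (packing_grown i)) addn1.
have -> : (\sum_i #|tverts (t i)|)%N = (\sum_v #|[set i | v \in tverts (t i)]|)%N.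
  transitivity (\sum_i \sum_(v in tverts (t i)) 1)%N.
    by apply: eq_bigr => i _; rewrite sum1_card.
  rewrite (exchange_big_dep predT) //=; apply: eq_bigr => v _.
  by rewrite -sum1_card; apply: eq_bigl => i; rewrite inE.
rewrite (big_morph Posz PoszD (erefl 0%:Z)) (eq_bigr (fun=> rank M [set: S])).
  by rewrite sumr_const -mulr_natr natz.
move=> v _; have [<- <-] := card_basis (packing_basis v); congr Posz.
by rewrite card_imset //; apply: packing_sigma_inj.
Qed.

(** Take the basis at some v in X. Each of its elements is located in X or roots a tree that reaches
    v from a root outside X. *)
Lemma packing_corank X : X != set0 ->
  corank M (located_in loc T X)
  <= #|[set i | (troot (t i) \notin X) && (X :&: tverts (t i) != set0)]|%:Z.
Proof.
case/set0Pn=> v vX; set N := finset _.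
have [rB _] := card_basis (packing_basis v).
have sub : [set sigma i | i : 'I_k & v \in tverts (t i)]
    \subset located_in loc T X :|: sigma @: N.
  apply/subsetP=> _ /imsetP[i vi ->]; rewrite !inE in vi *.
  have iT : sigma i \in T by apply: imset_f.
  rewrite iT /=; have [//|rX] := boolP (loc (sigma i) \in X).
  apply: imset_f; rewrite inE; have <- : loc (sigma i) = troot (t i) by case: pack.
  by rewrite rX /=; apply/set0Pn; exists v; rewrite inE vX.
have := rank_mono M sub; rewrite rB /corank => le1.
have := rankU_le M (located_in loc T X) (sigma @: N).
rewrite (card_imset _ packing_sigma_inj); lia.
Qed.

(** Count pairs of a tree and a block it meets that does not contain its root: by trees there are at
    most as many as crossing edges, by blocks at least the sum of the coranks. *)
Lemma packing_KT_value P : partition P [set: V] -> 0 <= KT_value ends loc M F T P.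
Proof.
move=> partP; rewrite KT_valueE subr_ge0.
have crE : crossing_edges ends F P = F :&: [set e | pblock P (ends e).1 != pblock P (ends e).2].
  by apply/setP=> e; rewrite !inE.
rewrite crE card_packing_edges.
apply: le_trans (_ : (\sum_i #|[set X in P | (troot (t i) \notin X)
   && (X :&: tverts (t i) != set0)]|)%N%:Z <= _); last first.
  rewrite lez_nat; apply: leq_sum => i _.
  apply: leq_trans (grown_crossing (packing_grown i) partP) _.
  by apply/subset_leq_card/subsetP=> e; rewrite !inE.
have -> : (\sum_i #|[set X in P | (troot (t i) \notin X) && (X :&: tverts (t i) != set0)]|)%N
    = (\sum_(X in P) #|[set i | (troot (t i) \notin X) && (X :&: tverts (t i) != set0)]|)%N.
  transitivity (\sum_i \sum_(X in P | (troot (t i) \notin X)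
      && (X :&: tverts (t i) != set0)) 1)%N.
    by apply: eq_bigr => i _; rewrite -sum1_card; apply: eq_bigl => X; rewrite inE.
  rewrite (exchange_big_dep (mem P)) /=; last by move=> i X _ /andP[].
  apply: eq_bigr => X XP; rewrite -sum1_card; apply: eq_bigl => i.
  by rewrite inE (XP : X \in P).
rewrite (big_morph Posz PoszD (erefl 0%:Z)); apply: ler_sum => X XP.
exact: packing_corank (partition_neq0 partP XP).
Qed.

Lemma packing_KT_rank : KT_rank ends loc M F T = #|F|%:Z + #|T|%:Z.
Proof.
apply/eqP; rewrite eq_le KT_rank_le_card /= card_packing /KT_rank lerDl.
by have [P partP ->] := KT_min_attained ends loc M F T; apply: packing_KT_value.
Qed.

End FromPacking.

(** * A packing from full rank *)

Section ToPacking.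

Variables (F : {set E}) (T : {set S}).
Hypothesis rankFT : KT_rank ends loc M F T = #|F|%:Z + #|T|%:Z.
Hypothesis cardFT : #|F|%:Z + #|T|%:Z = rank M [set: S] * #|V|%:Z.

Let B v := located_in loc T [set v].

Lemma sum_defect (X : {set V}) : \sum_(v in X) (rank M [set: S] - #|B v|%:Z)
  = rank M [set: S] * #|X|%:Z - #|located_in loc T X|%:Z.
Proof.
rewrite sumrB sumr_const -mulr_natr natz; congr (_ - _).
rewrite -(big_morph Posz PoszD (erefl 0%:Z)); congr Posz.
rewrite -[RHS]sum1_card (partition_big loc (mem X)) /=; last first.
  by move=> s; rewrite inE => /andP[].
apply: eq_bigr => v vX; rewrite -sum1_card; apply: eq_bigl => s; rewrite !inE.
by case: eqP => [->|_]; rewrite ?andbF // (vX : v \in X) !andbT.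
Qed.

Lemma KT_feasible : feasible ends M F B.
Proof.
have KT0 P : partition P [set: V] -> 0 <= KT_value ends loc M F T P.
  move=> /(KT_min_le ends loc M F T); apply: le_trans.
  by move: rankFT; rewrite /KT_rank cardFT; lia.
split=> [X X0|].
  (* At this partition the crossing edges are at most |F| minus those inside X, and each vertex v
     outside X subtracts at least k - |B(v)|. With |F| + |T| = k|V|, what remains is the bound on
     d(X). *)
  have partX := isolate_partition X0.
  have := KT0 _ partX; rewrite KT_valueE big_setU1 ?isolate_notin //=.
  rewrite big_imset => [/=|x y _ _]; last exact: set1_inj.
  have -> : span_at B X = located_in loc T X.
    apply/setP=> s; rewrite inE; apply/bigcupP/andP => [[v vX]|[sT sX]].
      by rewrite !inE => /andP[-> /eqP->].
    by exists (loc s); rewrite ?inE ?eqxx ?sT.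
  have : #|crossing_edges ends F (isolate X)|%:Z + #|inner ends F X|%:Z <= #|F|%:Z.
    rewrite -PoszD lez_nat -cardsUI.
    rewrite [X in (_ + X)%N](_ : _ = 0%N) ?addn0; last first.
      apply/eqP; rewrite cards_eq0; apply/eqP/setP=> e; rewrite in_set0 inE.
      apply/negP=> /andP[]; rewrite !inE => /andP[_ /negP cr] /and3P[_ xX yX]; apply: cr.
      by rewrite !(partition_pblock partX (setU11 _ _)).
    by apply/subset_leq_card/subsetP=> e; rewrite !inE => /orP[] /andP[].
  have : \sum_(v in ~: X) (rank M [set: S] - #|B v|%:Z) <= \sum_(v in ~: X) corank M (B v).
    by apply: ler_sum => v _; rewrite lerD2l lerN2 rank_le_card.
  have := sum_defect X; have := sum_defect (~: X); rewrite /defect.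
  have : (#|located_in loc T X| + #|located_in loc T (~: X)| = #|T|)%N.
    rewrite -(cardsID [set s | loc s \in X] T).
    by congr (_ + _)%N; apply: eq_card => s; rewrite !inE // andbC.
  have := cardsC X; move: cardFT.
  set a := \sum_(v in X) _; set b := \sum_(v in ~: X) _; set c := \sum_(v in ~: X) _.
  rewrite /corank => h1 h2 h3 h4 h5 h6 h7; nia.
rewrite /defect sum_defect cardsT.
have -> : located_in loc T [set: V] = T by apply/setP=> s; rewrite inE in_setT andbT.
have -> : inner ends F [set: V] = F.
  by apply/setP=> e; rewrite inE !in_setT; case: (e \in F).
by lia.
Qed.

Lemma packing_of_KT : exists (k : nat) (t : 'I_k -> rooted_subgraph V E) (sigma : 'I_k -> S),
  [/\ matroid_based_packing ends loc M t sigma, packing_edges t = F & packing_roots sigma = T].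
Proof.
have : partial_packing ends M loc F T F B (fun=> set0).
  split.
  - exact: KT_feasible.
  - by move=> v; apply/subsetP=> s; rewrite inE => /andP[].
  - move=> s sT; have -> : [set v | s \in B v] = [set loc s]; last exact: grown_root.
    by apply/setP=> v; rewrite !inE sT eq_sym.
  - by split=> [s _|s s' _ _ _]; rewrite -setI_eq0 set0I.
  - by rewrite big1 ?setU0.
case/complete_packing=> B' [C [feas BT gr [_ dis] FE]].
pose sigma (i : 'I_#|T|) := enum_val i.
have sigmaT i : sigma i \in T by apply: enum_valP.
pose t i := RootedSubgraph [set v | sigma i \in B' v] (C (sigma i)) (loc (sigma i)).
have sigma_inj : injective sigma by apply: enum_val_inj.
have sigmaK s : s \in T -> exists i, s = sigma i.
  by move=> sT; exists (enum_rank_in sT s); rewrite /sigma enum_rankK_in.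
exists #|T|, t, sigma; split; first split=> //.
- by move=> i; apply/rooted_tree_grown/gr.
- by move=> i j ij; apply: dis => //; rewrite (inj_eq sigma_inj).
- move=> v; have -> : [set sigma i | i : 'I_#|T| & v \in tverts (t i)] = B' v.
    apply/setP=> s; apply/imsetP/idP => [[i vi ->]|sB]; first by rewrite !inE in vi.
    have [i si] := sigmaK s (subsetP (BT v) s sB).
    by exists i; rewrite // !inE -si.
  have in0 X : #|inner ends set0 X| = 0%N.
    by apply/eqP; rewrite cards_eq0; apply/eqP/setP=> e; rewrite inE !in_set0.
  have le u : #|B' u|%:Z <= rank M (B' u).
    have u0 : [set u] != set0 by apply/set0Pn; exists u; rewrite inE.
    have := feas.1 _ u0; rewrite /defect in0 big_set1 span_at1; lia.
  have cB u : #|B' u|%:Z = rank M (B' u).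
    by apply/eqP; rewrite eq_le le rank_le_card.
  apply: indep_basis => //; apply/eqP; rewrite eq_le rank_le_k /= -subr_le0 -cB.
  have := feas.2; rewrite /defect in0 subr0 (bigD1 v) ?in_setT //=.
  have : 0 <= \sum_(u in [set: V] | u != v) (rank M [set: S] - #|B' u|%:Z).
    by apply: sumr_ge0 => u _; rewrite subr_ge0 cB rank_le_k.
  by move: (\sum_(u in _ | _) _) => a; lia.
- rewrite /packing_edges -FE set0U; apply/setP=> e; apply/bigcupP/bigcupP => [[i _ ei]|[s sT es]].
    by exists (sigma i).
  by have [i si] := sigmaK s sT; exists i; rewrite // /t /= -si.
- apply/setP=> s; apply/imsetP/idP => [[i _ ->] //|/sigmaK[i ->]]; by exists i.
Qed.

End ToPacking.
End Packing.

Theorem theorem6 (V E S : finType) (ends : E -> V * V) (loc : S -> V)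
    (M : matroid S) :
  exists M' : matroid (E + S)%type,
    (forall (F : {set E}) (T : {set S}),
       rank M' (disj_union F T) = KT_rank ends loc M F T)
    /\
    (forall (F : {set E}) (T : {set S}),
       (exists (k : nat) (t : 'I_k -> rooted_subgraph V E) (sigma : 'I_k -> S),
          [/\ matroid_based_packing ends loc M t sigma,
              packing_edges t = F
            & packing_roots sigma = T])
       <->
       (indep M' (disj_union F T)
        /\ #|disj_union F T|%:Z = rank M [set: S] * #|V|%:Z)).
Proof.
have [M' rM'] := KT_matroid ends loc M; exists M'; split=> // F T.
rewrite /indep rM' card_disj_union PoszD; split=> [[k [t [sigma [pack <- <-]]]]|[/eqP rFT cFT]].
  by rewrite (packing_KT_rank pack) eqxx (card_packing pack).
exact: packing_of_KT.
Qed.
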